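(* Let $\mathbf{N}$ be a $\mathbb{D}$-norm on $\mathbb{B}$. Then the function $\lceil\mathbf{N}\rceil:\mathbb{B}\to\mathbb{R}$ defined by $$\lceil\mathbf{N}\rceil(\omega):=\min\{\alpha\in\mathbb{R},\ \alpha\ge0:\ \alpha\ge\mathbf{N}(\omega)\}=\mathbf{N}(\omega)\vee\overline{\mathbf{N}(\omega)}$$ is a real norm on $\mathbb{B}$ (called the Riesz subnorm of $\mathbf{N}$) satisfying, for all $\varphi,\psi\in\mathbb{B}$: (i) $\lceil\mathbf{N}\rceil(\varphi)\le\lceil\mathbf{N}\rceil(\psi)$ whenever $\mathbf{N}(\varphi)\le\mathbf{N}(\psi)$; (ii) $\mathbf{N}(\varphi)\le\lceil\mathbf{N}\rceil(\varphi)$.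
   Context: $\mathbb{D}=\{x+\mathbf{j}y:x,y\in\mathbb{R}\}$, $\mathbf{j}^2=1$, $\mathbf{j}\notin\mathbb{R}$, is the algebra of hyperbolic numbers, containing $\mathbb{R}$. With $\mathbf{e}_1=\frac{1+\mathbf{j}}{2}$, $\mathbf{e}_2=\frac{1-\mathbf{j}}{2}$, each $z=x+\mathbf{j}y\in\mathbb{D}$ is $z=\pi_1(z)\mathbf{e}_1+\pi_2(z)\mathbf{e}_2$, where $\pi_1(z)=x+y$, $\pi_2(z)=x-y$. Conjugation: $\overline{x+\mathbf{j}y}=x-\mathbf{j}y$. Order: $z\le w$ iff $\pi_k(z)\le\pi_k(w)$ for $k=1,2$; $z\vee w$ denotes the supremum (componentwise maximum in $\mathbf{e}_1,\mathbf{e}_2$). $\mathbb{B}$ is the commutative real algebra of bicomplex numbers $a+b\mathbf{i}+c\mathbf{j}+d\mathbf{k}$ ($a,b,c,d\in\mathbb{R}$), with $\mathbf{i}^2=\mathbf{k}^2=-1$, $\mathbf{j}^2=1$, $\mathbf{i}\mathbf{k}=\mathbf{k}\mathbf{i}=\mathbf{j}$. A $\mathbb{D}$-norm on $\mathbb{B}$ is a function $\mathbf{N}:\mathbb{B}\to\mathbb{D}$ such that (i) $\mathbf{N}(\omega)=0$ implies $\omega=0$; (ii) $\mathbf{N}(\lambda\omega)=|\lambda|\mathbf{N}(\omega)$ for all $\lambda\in\mathbb{R}$, $\omega\in\mathbb{B}$; (iii) $\mathbf{N}(\omega+\psi)\le\mathbf{N}(\omega)+\mathbf{N}(\psi)$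 for all $\omega,\psi\in\mathbb{B}$. *)

(* Defs.v *)
From HB Require Import structures.
From mathcomp Require Import all_boot all_order all_algebra.
From mathcomp Require Import boolp classical_sets reals.
From mathcomp Require Import ring lra.

Set Implicit Arguments.
Unset Strict Implicit.
Unset Printing Implicit Defensive.

Import Order.TTheory GRing.Theory Num.Theory.

Local Open Scope ring_scope.

(* [Hyperbolic x y] is the hyperbolic number x + j y. *)
Record hyperbolic (R : Type) := Hyperbolic { hre : R; him : R }.

Definition pair_of_hyperbolic (R : Type) (z : hyperbolic R) : R * R :=
  (hre z, him z).
Definition hyperbolic_of_pair (R : Type) (p : R * R) : hyperbolic R :=
  Hyperbolic p.1 p.2.
Lemma pair_of_hyperbolicK (R : Type) :
  cancel (@pair_of_hyperbolic R) (@hyperbolic_of_pair R).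
Proof. by case. Qed.

HB.instance Definition _ (R : eqType) :=
  Equality.copy (hyperbolic R) (can_type (@pair_of_hyperbolicK R)).
HB.instance Definition _ (R : choiceType) :=
  Choice.copy (hyperbolic R) (can_type (@pair_of_hyperbolicK R)).

Section HyperbolicAlgebra.
Variable R : realType.
Implicit Types z w u : hyperbolic R.

Definition hyp_zero : hyperbolic R := Hyperbolic 0 0.
Definition hyp_one : hyperbolic R := Hyperbolic 1 0.
Definition hyp_opp z : hyperbolic R := Hyperbolic (- hre z) (- him z).
Definition hyp_add z w : hyperbolic R :=
  Hyperbolic (hre z + hre w) (him z + him w).
(* (x + j y)(x' + j y') with j^2 = 1 *)
Definition hyp_mul z w : hyperbolic R :=
  Hyperbolic (hre z * hre w + him z * him w) (hre z * him w + him z * hre w).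
Definition hyp_scale (a : R) z : hyperbolic R :=
  Hyperbolic (a * hre z) (a * him z).

Fact hyp_addA : associative hyp_add.
Proof. by case=> ? ? [? ?] [? ?]; congr Hyperbolic; rewrite /= addrA. Qed.
Fact hyp_addC : commutative hyp_add.
Proof. by case=> ? ? [? ?]; congr Hyperbolic; rewrite /= addrC. Qed.
Fact hyp_add0 : left_id hyp_zero hyp_add.
Proof. by case=> ? ?; congr Hyperbolic; rewrite /= add0r. Qed.
Fact hyp_addN : left_inverse hyp_zero hyp_opp hyp_add.
Proof. by case=> ? ?; congr Hyperbolic; rewrite /= addNr. Qed.

HB.instance Definition _ := GRing.isZmodule.Build (hyperbolic R)
  hyp_addA hyp_addC hyp_add0 hyp_addN.

Fact hyp_mulA : associative hyp_mul.
Proof. by case=> ? ? [? ?] [? ?]; congr Hyperbolic; rewrite /=; ring. Qed.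
Fact hyp_mulC : commutative hyp_mul.
Proof. by case=> ? ? [? ?]; congr Hyperbolic; rewrite /=; ring. Qed.
Fact hyp_mul1 : left_id hyp_one hyp_mul.
Proof. by case=> ? ?; congr Hyperbolic; rewrite /=; ring. Qed.
Fact hyp_mulD : left_distributive hyp_mul +%R.
Proof. by case=> ? ? [? ?] [? ?]; congr Hyperbolic; rewrite /=; ring. Qed.
Fact hyp_one_neq0 : hyp_one != 0.
Proof. by apply/eqP => -[/eqP]; rewrite oner_eq0. Qed.

HB.instance Definition _ := GRing.Zmodule_isComNzRing.Build (hyperbolic R)
  hyp_mulA hyp_mulC hyp_mul1 hyp_mulD hyp_one_neq0.

Fact hyp_scaleA a b z : hyp_scale a (hyp_scale b z) = hyp_scale (a * b) z.
Proof. by case: z => ? ?; congr Hyperbolic; rewrite /= mulrA. Qed.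
Fact hyp_scale1 : left_id 1 hyp_scale.
Proof. by case=> ? ?; congr Hyperbolic; rewrite /= mul1r. Qed.
Fact hyp_scaleDr : right_distributive hyp_scale +%R.
Proof. by move=> ? [? ?] [? ?]; congr Hyperbolic; rewrite /= mulrDr. Qed.
Fact hyp_scaleDl z : {morph hyp_scale^~ z : a b / a + b}.
Proof. by case: z => ? ? ? ?; congr Hyperbolic; rewrite /= mulrDl. Qed.

HB.instance Definition _ := GRing.Zmodule_isLmodule.Build R (hyperbolic R)
  hyp_scaleA hyp_scale1 hyp_scaleDr hyp_scaleDl.

Fact hyp_scaleAl a z w : a *: (z * w) = a *: z * w.
Proof. by case: z w => ? ? [? ?]; congr Hyperbolic; rewrite /=; ring. Qed.

HB.instance Definition _ := GRing.Lmodule_isLalgebra.Build R (hyperbolic R)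
  hyp_scaleAl.
HB.instance Definition _ := GRing.Lalgebra_isComAlgebra.Build R (hyperbolic R).

Definition hyp_j : hyperbolic R := Hyperbolic 0 1.
Definition hyp_e1 : hyperbolic R := 2^-1 *: (1 + hyp_j).
Definition hyp_e2 : hyperbolic R := 2^-1 *: (1 - hyp_j).
Definition hyp_pi1 z : R := hre z + him z.
Definition hyp_pi2 z : R := hre z - him z.
Definition hyp_conj z : hyperbolic R := Hyperbolic (hre z) (- him z).

Lemma hyp_jj : hyp_j * hyp_j = 1.
Proof. by congr Hyperbolic; rewrite /=; ring. Qed.

Lemma hypE z : z = (hre z)%:A + him z *: hyp_j.
Proof. by case: z => x y; congr Hyperbolic; rewrite /=; ring. Qed.

Lemma hyp_e12E z : z = hyp_pi1 z *: hyp_e1 + hyp_pi2 z *: hyp_e2.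
Proof.
by case: z => x y; congr Hyperbolic; rewrite /hyp_pi1 /hyp_pi2 /=; field.
Qed.

Lemma hyp_pi1_e12 a b : hyp_pi1 (a *: hyp_e1 + b *: hyp_e2) = a.
Proof. by rewrite /hyp_pi1 /=; field. Qed.

Lemma hyp_pi2_e12 a b : hyp_pi2 (a *: hyp_e1 + b *: hyp_e2) = b.
Proof. by rewrite /hyp_pi2 /=; field. Qed.

Definition hyp_le z w : bool :=
  (hyp_pi1 z <= hyp_pi1 w) && (hyp_pi2 z <= hyp_pi2 w).

Fact hyp_le_refl : reflexive hyp_le.
Proof. by move=> z; rewrite /hyp_le !lexx. Qed.
Fact hyp_le_anti : antisymmetric hyp_le.
Proof.
move=> z w /andP[/andP[le1 le2] /andP[ge1 ge2]].
rewrite [z]hyp_e12E [w]hyp_e12E.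
by congr (_ *: _ + _ *: _); apply/le_anti; rewrite ?le1 ?le2.
Qed.
Fact hyp_le_trans : transitive hyp_le.
Proof.
move=> w z u /andP[zw1 zw2] /andP[wu1 wu2].
by rewrite /hyp_le (le_trans zw1 wu1) (le_trans zw2 wu2).
Qed.

HB.instance Definition _ := Order.Le_isPOrder.Build ring_display (hyperbolic R)
  hyp_le_refl hyp_le_anti hyp_le_trans.

Definition hyp_meet z w : hyperbolic R :=
  Num.min (hyp_pi1 z) (hyp_pi1 w) *: hyp_e1 +
  Num.min (hyp_pi2 z) (hyp_pi2 w) *: hyp_e2.
Definition hyp_join z w : hyperbolic R :=
  Num.max (hyp_pi1 z) (hyp_pi1 w) *: hyp_e1 +
  Num.max (hyp_pi2 z) (hyp_pi2 w) *: hyp_e2.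

Fact hyp_meetP u z w : (u <= hyp_meet z w) = (u <= z) && (u <= w).
Proof.
rewrite /Order.le /= /hyp_le hyp_pi1_e12 hyp_pi2_e12 !le_min.
by rewrite andbACA.
Qed.
Fact hyp_joinP u z w : (hyp_join u z <= w) = (u <= w) && (z <= w).
Proof.
rewrite /Order.le /= /hyp_le hyp_pi1_e12 hyp_pi2_e12 !ge_max.
by rewrite andbACA.
Qed.

HB.instance Definition _ :=
  Order.POrder_MeetJoin_isLattice.Build ring_display (hyperbolic R)
    hyp_meetP hyp_joinP.

End HyperbolicAlgebra.

(* [Bicomplex a b c d] is the bicomplex number a + b i + c j + d k. *)
Record bicomplex (R : Type) :=
  Bicomplex { bre : R; bim_i : R; bim_j : R; bim_k : R }.

Definition tuple_of_bicomplex (R : Type) (w : bicomplex R) : R * R * R * R :=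
  (bre w, bim_i w, bim_j w, bim_k w).
Definition bicomplex_of_tuple (R : Type) (p : R * R * R * R) : bicomplex R :=
  let: (a, b, c, d) := p in Bicomplex a b c d.
Lemma tuple_of_bicomplexK (R : Type) :
  cancel (@tuple_of_bicomplex R) (@bicomplex_of_tuple R).
Proof. by case. Qed.

HB.instance Definition _ (R : eqType) :=
  Equality.copy (bicomplex R) (can_type (@tuple_of_bicomplexK R)).
HB.instance Definition _ (R : choiceType) :=
  Choice.copy (bicomplex R) (can_type (@tuple_of_bicomplexK R)).

Section BicomplexAlgebra.
Variable R : realType.
Implicit Types z w : bicomplex R.

Definition bic_zero : bicomplex R := Bicomplex 0 0 0 0.
Definition bic_one : bicomplex R := Bicomplex 1 0 0 0.
Definition bic_opp z : bicomplex R :=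
  Bicomplex (- bre z) (- bim_i z) (- bim_j z) (- bim_k z).
Definition bic_add z w : bicomplex R :=
  Bicomplex (bre z + bre w) (bim_i z + bim_i w)
            (bim_j z + bim_j w) (bim_k z + bim_k w).
(* i^2 = k^2 = -1, j^2 = 1, ik = ki = j, hence ij = ji = -k, jk = kj = -i. *)
Definition bic_mul z w : bicomplex R :=
  let: Bicomplex a b c d := z in
  let: Bicomplex a' b' c' d' := w in
  Bicomplex (a * a' - b * b' + c * c' - d * d')
            (a * b' + b * a' - c * d' - d * c')
            (a * c' + c * a' + b * d' + d * b')
            (a * d' + d * a' - b * c' - c * b').
Definition bic_scale (a : R) z : bicomplex R :=
  Bicomplex (a * bre z) (a * bim_i z) (a * bim_j z) (a * bim_k z).

Fact bic_addA : associative bic_add.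
Proof.
by case=> ? ? ? ? [? ? ? ?] [? ? ? ?]; congr Bicomplex; rewrite /= addrA.
Qed.
Fact bic_addC : commutative bic_add.
Proof. by case=> ? ? ? ? [? ? ? ?]; congr Bicomplex; rewrite /= addrC. Qed.
Fact bic_add0 : left_id bic_zero bic_add.
Proof. by case=> ? ? ? ?; congr Bicomplex; rewrite /= add0r. Qed.
Fact bic_addN : left_inverse bic_zero bic_opp bic_add.
Proof. by case=> ? ? ? ?; congr Bicomplex; rewrite /= addNr. Qed.

HB.instance Definition _ := GRing.isZmodule.Build (bicomplex R)
  bic_addA bic_addC bic_add0 bic_addN.

Fact bic_mulA : associative bic_mul.
Proof.
by case=> ? ? ? ? [? ? ? ?] [? ? ? ?]; congr Bicomplex; rewrite /=; ring.
Qed.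
Fact bic_mulC : commutative bic_mul.
Proof. by case=> ? ? ? ? [? ? ? ?]; congr Bicomplex; rewrite /=; ring. Qed.
Fact bic_mul1 : left_id bic_one bic_mul.
Proof. by case=> ? ? ? ?; congr Bicomplex; rewrite /=; ring. Qed.
Fact bic_mulD : left_distributive bic_mul +%R.
Proof.
by case=> ? ? ? ? [? ? ? ?] [? ? ? ?]; congr Bicomplex; rewrite /=; ring.
Qed.
Fact bic_one_neq0 : bic_one != 0.
Proof. by apply/eqP => -[/eqP]; rewrite oner_eq0. Qed.

HB.instance Definition _ := GRing.Zmodule_isComNzRing.Build (bicomplex R)
  bic_mulA bic_mulC bic_mul1 bic_mulD bic_one_neq0.

Fact bic_scaleA a b z : bic_scale a (bic_scale b z) = bic_scale (a * b) z.
Proof. by case: z => ? ? ? ?; congr Bicomplex; rewrite /= mulrA. Qed.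
Fact bic_scale1 : left_id 1 bic_scale.
Proof. by case=> ? ? ? ?; congr Bicomplex; rewrite /= mul1r. Qed.
Fact bic_scaleDr : right_distributive bic_scale +%R.
Proof.
by move=> ? [? ? ? ?] [? ? ? ?]; congr Bicomplex; rewrite /= mulrDr.
Qed.
Fact bic_scaleDl z : {morph bic_scale^~ z : a b / a + b}.
Proof. by case: z => ? ? ? ? ? ?; congr Bicomplex; rewrite /= mulrDl. Qed.

HB.instance Definition _ := GRing.Zmodule_isLmodule.Build R (bicomplex R)
  bic_scaleA bic_scale1 bic_scaleDr bic_scaleDl.

Fact bic_scaleAl a z w : a *: (z * w) = a *: z * w.
Proof.
by case: z w => ? ? ? ? [? ? ? ?]; congr Bicomplex; rewrite /=; ring.
Qed.

HB.instance Definition _ := GRing.Lmodule_isLalgebra.Build R (bicomplex R)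
  bic_scaleAl.
HB.instance Definition _ := GRing.Lalgebra_isComAlgebra.Build R (bicomplex R).

Definition bic_i : bicomplex R := Bicomplex 0 1 0 0.
Definition bic_j : bicomplex R := Bicomplex 0 0 1 0.
Definition bic_k : bicomplex R := Bicomplex 0 0 0 1.

Lemma bicE w :
  w = (bre w)%:A + bim_i w *: bic_i + bim_j w *: bic_j + bim_k w *: bic_k.
Proof. by case: w => ? ? ? ?; congr Bicomplex; rewrite /=; ring. Qed.

Lemma bic_ii : bic_i * bic_i = -1.
Proof. by congr Bicomplex; rewrite /=; ring. Qed.
Lemma bic_jj : bic_j * bic_j = 1.
Proof. by congr Bicomplex; rewrite /=; ring. Qed.
Lemma bic_kk : bic_k * bic_k = -1.
Proof. by congr Bicomplex; rewrite /=; ring. Qed.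
Lemma bic_ik : bic_i * bic_k = bic_j.
Proof. by congr Bicomplex; rewrite /=; ring. Qed.

End BicomplexAlgebra.

Record is_Dnorm (R : realType) (N : bicomplex R -> hyperbolic R) : Prop :=
  IsDnorm {
    Dnorm_eq0 : forall w, N w = 0 -> w = 0;
    DnormZ : forall (a : R) w, N (a *: w) = `|a| *: N w;
    DnormD : forall w z, N (w + z) <= N w + N z }.

Record is_real_norm (R : realType) (V : lmodType R) (f : V -> R) : Prop :=
  IsRealNorm {
    real_norm_ge0 : forall v, 0 <= f v;
    real_norm_eq0 : forall v, f v = 0 -> v = 0;
    real_normZ : forall (a : R) v, f (a *: v) = `|a| * f v;
    real_normD : forall u v, f (u + v) <= f u + f v }.

(* The real number a, seen in the hyperbolic numbers, is a%:A. *)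
Definition riesz_bounds (R : realType) (N : bicomplex R -> hyperbolic R)
    (w : bicomplex R) : set R :=
  [set a : R | 0 <= a /\ N w <= a%:A]%classic.

(* Defined as an infimum, so as to be total; that it is attained is part of
   what has to be proved about it. *)
Definition riesz_subnorm (R : realType) (N : bicomplex R -> hyperbolic R)
    (w : bicomplex R) : R :=
  inf (riesz_bounds N w).

(* Main.v *)
(* In the coordinates (pi1, pi2) the condition N w <= a says that the real
   number a dominates both pi1 (N w) and pi2 (N w). Since N w = N (- w), the
   triangle inequality forces N w >= 0, so the least such a is
   max (pi1 (N w)) (pi2 (N w)); the norm axioms pass to the maximum, and it is
   the join of N w and its conjugate because conjugation exchanges pi1 and
   pi2. *)
Require Import Defs.
From mathcomp Require Import all_boot all_order all_algebra.
From mathcomp Require Import boolp classical_sets reals.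

Import Order.TTheory GRing.Theory Num.Theory.

Local Open Scope ring_scope.

Section HyperbolicCoordinates.
Variable R : realType.
Implicit Types (a : R) (z w : hyperbolic R).

Lemma hyp_leE z w :
  (z <= w) = (hyp_pi1 z <= hyp_pi1 w) && (hyp_pi2 z <= hyp_pi2 w).
Proof. by []. Qed.

Lemma hyp_pi1D z w : hyp_pi1 (z + w) = hyp_pi1 z + hyp_pi1 w.
Proof. by rewrite /hyp_pi1 /= addrACA. Qed.

Lemma hyp_pi2D z w : hyp_pi2 (z + w) = hyp_pi2 z + hyp_pi2 w.
Proof. by rewrite /hyp_pi2 /= opprD addrACA. Qed.

Lemma hyp_pi1Z a z : hyp_pi1 (a *: z) = a * hyp_pi1 z.
Proof. by rewrite /hyp_pi1 /= mulrDr. Qed.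

Lemma hyp_pi2Z a z : hyp_pi2 (a *: z) = a * hyp_pi2 z.
Proof. by rewrite /hyp_pi2 /= mulrBr. Qed.

Lemma hyp_pi1_real a : hyp_pi1 a%:A = a.
Proof. by rewrite /hyp_pi1 /= mulr1 mulr0 addr0. Qed.

Lemma hyp_pi2_real a : hyp_pi2 a%:A = a.
Proof. by rewrite /hyp_pi2 /= mulr1 mulr0 subr0. Qed.

Lemma hyp_pi1_0 : hyp_pi1 (0 : hyperbolic R) = 0.
Proof. by rewrite /hyp_pi1 /= addr0. Qed.

Lemma hyp_pi2_0 : hyp_pi2 (0 : hyperbolic R) = 0.
Proof. by rewrite /hyp_pi2 /= subr0. Qed.

(** Both coordinates of a real number equal that number, so the two inequalities of the order merge
    into one bound on a maximum. This turns every hyperbolic bound by a real into a statement inside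
    [R]. *)
Lemma hyp_le_real z a :
  (z <= a%:A) = (Num.max (hyp_pi1 z) (hyp_pi2 z) <= a).
Proof. by rewrite hyp_leE hyp_pi1_real hyp_pi2_real ge_max. Qed.

Lemma hyp_join_conj z :
  Order.join z (hyp_conj z) = (Num.max (hyp_pi1 z) (hyp_pi2 z))%:A.
Proof.
rewrite [RHS]hyp_e12E hyp_pi1_real hyp_pi2_real.
have pi1C : hyp_pi1 (hyp_conj z) = hyp_pi2 z by [].
have pi2C : hyp_pi2 (hyp_conj z) = hyp_pi1 z by rewrite /hyp_pi2 /= opprK.
(* Only the [hyp_e2] coefficient shows the two coordinates in swapped order. *)
by rewrite [LHS]/(hyp_join _ _) /hyp_join pi1C pi2C [in X in _ + X]maxC.
Qed.

End HyperbolicCoordinates.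

Section RieszSubnorm.
Variables (R : realType) (N : bicomplex R -> hyperbolic R).
Hypothesis hN : is_Dnorm N.

Lemma Dnorm_ge0 w : 0 <= N w.
Proof.
have N0 : N 0 = 0.
  by rewrite -(scale0r (0 : bicomplex R)) (DnormZ hN) normr0 scale0r.
have NN : N (- w) = N w by rewrite -scaleN1r (DnormZ hN) normrN1 scale1r.
(* This reads [0 <= N w + N w], which is then halved in each coordinate. *)
have := DnormD hN w (- w).
rewrite subrr N0 NN !hyp_leE hyp_pi1D hyp_pi2D hyp_pi1_0 hyp_pi2_0.
by rewrite -!mulr2n !pmulrn_lge0.
Qed.

Lemma Dnorm_pi_ge0 w : 0 <= hyp_pi1 (N w) /\ 0 <= hyp_pi2 (N w).
Proof.
by have := Dnorm_ge0 w; rewrite hyp_leE hyp_pi1_0 hyp_pi2_0 => /andP.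
Qed.

(** The maximum is a lower bound of [riesz_bounds N w] and also belongs to it, the sign condition
    holding by [Dnorm_pi_ge0]; the infimum is therefore attained there. *)
Lemma riesz_subnormE w :
  riesz_subnorm N w = Num.max (hyp_pi1 (N w)) (hyp_pi2 (N w)).
Proof.
set m := Num.max _ _.
have m_lb : lbound (riesz_bounds N w) m by move=> a [_]; rewrite hyp_le_real.
have m_in : riesz_bounds N w m.
  by split; rewrite ?hyp_le_real // le_max (Dnorm_pi_ge0 w).1.
apply/eqP; rewrite eq_le; apply/andP; split.
  (* Here [m] witnesses that the set is bounded below; in the next step it witnesses that the set is
     nonempty. *)
  by apply: ge_inf => //; exists m.
by apply: lb_le_inf => //; exists m.
Qed.

Lemma riesz_subnorm_real_norm : is_real_norm (riesz_subnorm N).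
Proof.
split=> [w|w|a w|w z]; rewrite !riesz_subnormE.
- by rewrite le_max (Dnorm_pi_ge0 w).1.
- have [ge1 ge2] := Dnorm_pi_ge0 w.
  move=> max0; apply: (Dnorm_eq0 hN).
  (* A zero maximum gives [N w <= 0], and antisymmetry with [Dnorm_ge0] concludes. *)
  have /andP[le1 le2] : (hyp_pi1 (N w) <= 0) && (hyp_pi2 (N w) <= 0).
    by rewrite -ge_max max0.
  by apply/eqP; rewrite eq_le Dnorm_ge0 hyp_leE hyp_pi1_0 hyp_pi2_0 le1 le2.
- by rewrite (DnormZ hN) hyp_pi1Z hyp_pi2Z maxr_pMr.
- have := DnormD hN w z; rewrite hyp_leE hyp_pi1D hyp_pi2D => /andP[le1 le2].
  (* Each coordinate of the sum is bounded separately, its two summands lying below their respective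
     maxima. *)
  rewrite ge_max (le_trans le1) ?(le_trans le2) //;
  by rewrite lerD // le_max lexx ?orbT.
Qed.

End RieszSubnorm.

Theorem proposition3p9 (R : realType) (N : bicomplex R -> hyperbolic R)
    (hN : is_Dnorm N) :
  [/\ forall w : bicomplex R,
        riesz_bounds N w (riesz_subnorm N w) /\
        lbound (riesz_bounds N w) (riesz_subnorm N w),
      forall w : bicomplex R,
        (riesz_subnorm N w)%:A = Order.join (N w) (hyp_conj (N w)),
      is_real_norm (riesz_subnorm N),
      forall phi psi : bicomplex R,
        N phi <= N psi -> riesz_subnorm N phi <= riesz_subnorm N psi
    & forall phi : bicomplex R, N phi <= (riesz_subnorm N phi)%:A].
Proof.
have le_riesz w : N w <= (riesz_subnorm N w)%:A.
  by rewrite hyp_le_real (riesz_subnormE _ _ hN).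
have riesz_norm := riesz_subnorm_real_norm _ _ hN.
split=> // [w|w|phi psi le_phi_psi].
- split; first by split=> //; exact: real_norm_ge0.
  by move=> a [_]; rewrite hyp_le_real (riesz_subnormE _ _ hN).
- by rewrite hyp_join_conj (riesz_subnormE _ _ hN).
- by rewrite [leLHS](riesz_subnormE _ _ hN) -hyp_le_real (le_trans le_phi_psi).
Qed.
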